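(* Let $k\ge 1$ and $n>k+1$ be integers, and let $\omega=\omega_{n,k}$ be the largest zero of $T_n^{(k+1)}$. Then $$ \tau_{n,k}\leq \frac{(2k-1)!!}{(n+k-1)(n+k-3)\cdots(n-k+1)}\,\frac{1}{(1-\omega^2)^{k/2}}. $$
   Context: $T_n$ is the $n$-th Chebyshev polynomial of the first kind, $T_n(\cos\theta)=\cos n\theta$, and $T_n^{(k)}$ is its $k$-th derivative. For integers $k\ge1$ and $n\geq k+2$, $\omega_{n,k}$ denotes the largest (rightmost) zero of the polynomial $T_n^{(k+1)}$ (all of whose zeros are real and lie in $(-1,1)$), and $$\tau_{n,k}:=\frac{|T_n^{(k)}(\omega_{n,k})|}{T_n^{(k)}(1)}.$$ Notation: $(2k-1)!!=1\cdot3\cdots(2k-1)$. The product $(n+k-1)(n+k-3)\cdots(n-k+1)$ has $k$ factors decreasing in steps of $2$, i.e. it equals $\prod_{j=1}^{k}(n+k+1-2j)$. *)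

(* Defs.v *)
From mathcomp Require Import all_boot all_order all_algebra.
From mathcomp Require Import reals exp trigo.
From mathcomp Require Import ring.

Set Implicit Arguments.
Unset Strict Implicit.
Unset Printing Implicit Defensive.

Import Order.TTheory GRing.Theory Num.Theory.
Local Open Scope ring_scope.

(* Chebyshev polynomials of the first kind, by the three-term recurrence;
   [chebyshevT_cos] and [chebyshevT_unique] below show that [chebyshevT R n] is
   the unique polynomial p such that p(cos t) = cos (n t) for all t. *)
Fixpoint chebyshevT (R : realType) (n : nat) : {poly R} :=
  match n with
  | 0 => 1
  | m.+1 => match m with
            | 0 => 'X
            | l.+1 => 2%:P * 'X * chebyshevT R m - chebyshevT R l
            end
  end.

Lemma chebyshevTSS (R : realType) (n : nat) :
  chebyshevT R n.+2 = 2%:P * 'X * chebyshevT R n.+1 - chebyshevT R n.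
Proof. by []. Qed.

Lemma chebyshevT_cos (R : realType) (n : nat) (t : R) :
  (chebyshevT R n).[cos t] = cos (n%:R * t).
Proof.
suff: (chebyshevT R n).[cos t] = cos (n%:R * t) /\
      (chebyshevT R n.+1).[cos t] = cos (n.+1%:R * t) by case.
elim: n => [|n [IH0 IH1]].
  by rewrite /= hornerC hornerX mul0r mul1r cos0.
split=> //.
rewrite chebyshevTSS hornerD hornerN !hornerM hornerC hornerX IH0 IH1.
have -> : n.+2%:R * t = n.+1%:R * t + t by rewrite -[in LHS]addn1 natrD; ring.
have -> : n%:R * t = n.+1%:R * t - t by rewrite -[in RHS]addn1 natrD; ring.
rewrite cosB cosD; ring.
Qed.

Lemma chebyshevT_unique (R : realType) (n : nat) (p : {poly R}) :
  (forall t : R, p.[cos t] = cos (n%:R * t)) -> p = chebyshevT R n.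
Proof.
move=> hp; apply/eqP; rewrite -subr_eq0; apply/negPn/negP => q0.
set q := p - _ in q0.
pose s := [seq (i.+1%:R : R)^-1 | i <- iota 0 (size q)].
have us : uniq s.
  rewrite map_inj_uniq ?iota_uniq// => i j /invr_inj /eqP.
  by rewrite eqr_nat => /eqP [].
have rs : all (root q) s.
  apply/allP => _ /mapP[i _ ->].
  have i1 : -1 <= (i.+1%:R : R)^-1 <= 1.
    rewrite invf_le1 ?ltr0n// ler1n andbT.
    by rewrite (@le_trans _ _ 0)// ?lerN10// invr_ge0.
  rewrite /root -(acosK i1) /q hornerD hornerN hp chebyshevT_cos.
  by rewrite subrr.
by have := max_poly_roots q0 rs us; rewrite size_map size_iota ltnn.
Qed.

Definition is_largest_root (R : realType) (p : {poly R}) (w : R) : Prop :=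
  root p w /\ forall x : R, root p x -> x <= w.

(* The ratio |T_n^(k)(w)| / T_n^(k)(1); tau_{n,k} is its value at the largest
   zero w of T_n^(k+1). *)
Definition tau (R : realType) (n k : nat) (w : R) : R :=
  `|((chebyshevT R n)^`(k)).[w]| / ((chebyshevT R n)^`(k)).[1].

(* (2k-1)!! = 1 * 3 * ... * (2k-1) *)
Definition odd_dfact (k : nat) : nat := (\prod_(i < k) (2 * i + 1))%N.

(* Main.v *)
(* Write w = cos t and c = cot t. The functions u_k = sin^k t * T_n^(k)(cos t) and
   their companions v_k built from S_n(x) = sin(n arccos x) instead of T_n satisfy
   y_(k+2) = (2k+1) c y_(k+1) - (n^2-k^2) y_k, because both T_n and S_n solve the
   Chebyshev equation. Hence u_k v_(k+1) - u_(k+1) v_k = - n prod_(j<k) (n^2-j^2),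
   while the envelope G_k = u_k^2 + v_k^2 is a polynomial in q = 1 + c^2 with
   nonnegative coefficients; together with H_k = u_k u_(k+1) + v_k v_(k+1) this
   gives G_(k+2) >= (n^2-k^2)^2 G_k, with equality at t = pi/2, and so
   G_(k+1) >= (n prod_(j=1..k) (n+k+1-2j))^2. At a zero of T_n^(k+1) we have
   u_(k+1) = 0, so u_k^2 G_(k+1) is the squared Wronskian, and the bound on |u_k|
   follows from (2k-1)!! T_n^(k)(1) = prod_(j<k) (n^2-j^2). *)

Require Import Defs.
From mathcomp Require Import all_boot all_order all_algebra.
From mathcomp Require Import reals exp trigo.
From mathcomp Require Import ring lra.

Set Implicit Arguments.
Unset Strict Implicit.
Unset Printing Implicit Defensive.

Import Order.TTheory GRing.Theory Num.Theory.
Local Open Scope ring_scope.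

(* The coefficient [binomial(k+m-1, 2m) ((2m-1)!!)^2 a^2 prod_(m<j<k) (a^2-j^2)]
   of [q^m] in [G_k], arranged so that it is a product of one-step ratios in [k]. *)
Definition envCoef (R : realFieldType) (a : R) (k m : nat) : R :=
  if (m < k)%N then
    a ^+ 2 * (\prod_(i < m) (2 * i%:R + 1)) ^+ 2 *
    \prod_(m.+1 <= j < k) ((a ^+ 2 - j%:R ^+ 2) * (j%:R + m%:R) / (j%:R - m%:R))
  else 0.

(** * Recurrences for the envelope coefficients, in [k] and in [m] *)

Section EnvelopeCoefficients.
Variables (R : realFieldType) (a : R).
Local Notation A := (envCoef a).

Lemma envCoef_out k m : (k <= m)%N -> A k m = 0.
Proof. by move=> h; rewrite /envCoef ltnNge h. Qed.

Lemma envCoef_diag m : A m.+1 m = a ^+ 2 * (\prod_(i < m) (2 * i%:R + 1)) ^+ 2.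
Proof. by rewrite /envCoef ltnSn big_geq // mulr1. Qed.

Lemma envCoefS k m : (m < k)%N ->
  A k.+1 m = A k m * ((a ^+ 2 - k%:R ^+ 2) * (k%:R + m%:R) / (k%:R - m%:R)).
Proof.
by move=> h; rewrite /envCoef h ltnS (ltnW h) big_nat_recr //= -!mulrA.
Qed.

Lemma natr_sub_gt0 k m : (m < k)%N -> 0 < k%:R - m%:R :> R.
Proof. by move=> h; rewrite subr_gt0 ltr_nat. Qed.

(** Denominator-free form of the one-step ratio, so that [m] need not lie below [k]: at [m = k] both
    sides vanish because [A k k] is 0. *)
Lemma envCoef_mulS k m :
  (k%:R - m%:R) * A k.+1 m = (a ^+ 2 - k%:R ^+ 2) * (k%:R + m%:R) * A k m.
Proof.
case: (ltngtP m k) => h.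
- have := natr_sub_gt0 h; rewrite envCoefS // => d0; field.
  by rewrite gt_eqF.
- by rewrite !envCoef_out ?(ltnW h) // !mulr0.
- by rewrite h subrr mul0r envCoef_out // mulr0.
Qed.

(** Links neighbouring powers of q at a fixed [k]. Both sides vanish for [k <= m.+1]; above that,
    induction on [k] compares the one-step ratios of the two coefficients. *)
Lemma envCoef_shift k m :
  (k%:R - m%:R - 1) * (k%:R + m%:R) * (2 * m%:R + 1) * A k m =
  (a ^+ 2 - m.+1%:R ^+ 2) * (2 * m%:R + 2) * A k m.+1.
Proof.
case: (ltnP m.+1 k) => [|h]; last first.
  rewrite (envCoef_out h) mulr0.
  case: (ltngtP k m.+1) h => // [h _|-> _].
    by rewrite envCoef_out ?mulr0.
  by rewrite -(natr1 m); ring.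
elim: k => // k IH; rewrite ltnS leq_eqVlt => /orP[/eqP <-|h].
  have -> : A m.+2 m = A m.+1 m *
      ((a ^+ 2 - m.+1%:R ^+ 2) * (m.+1%:R + m%:R) / (m.+1%:R - m%:R)).
    by rewrite envCoefS.
  rewrite !envCoef_diag big_ord_recr /= -(natr1 m.+1) -(natr1 m).
  field.
  by rewrite [X in X != 0](_ : _ = 1) ?oner_eq0 //; ring.
have h1 : (m < k)%N by exact: ltnW.
have d1 := natr_sub_gt0 h; have d0 := natr_sub_gt0 h1.
have {}IH := IH h.
rewrite (envCoefS h1) (envCoefS h).
rewrite -(natr1 k); move: IH d1 d0; rewrite -(natr1 m) => IH d1 d0.
set x := (k%:R : R) in IH d1 d0 *; set y := (m%:R : R) in IH d1 d0 *.
have dn1 : x - (y + 1) != 0 by rewrite gt_eqF.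
have dn0 : x - y != 0 by rewrite gt_eqF.
transitivity (((x - y - 1) * (x + y) * (2 * y + 1) * A k m) *
   ((a ^+ 2 - x ^+ 2) * (x + y + 1) / (x - (y + 1)))).
  by field; rewrite dn0 dn1.
by rewrite IH; field.
Qed.

(* Coefficients of [q^m] in
   [G_(k+2) = (2k+1) c^2 (2 H_(k+1) / c - (2k+1) G_(k+1)) + (a^2-k^2)^2 G_k],
   where [c^2 = q - 1] and [H_k / c] has coefficients [(k+m) envCoef a k m]. *)
Lemma envCoef_rec k m : (0 < k)%N ->
  A k.+2 m = (2 * k%:R + 1) *
     ((if m is l.+1 then (2 * l%:R + 1) * A k.+1 l else 0)
      - (2 * m%:R + 1) * A k.+1 m)
   + (a ^+ 2 - k%:R ^+ 2) ^+ 2 * A k m.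
Proof.
move=> k0.
have k0R : 0 < k%:R :> R by rewrite ltr0n.
have km : 0 < k%:R + m%:R :> R by rewrite ltr_wpDr.
have kmn : k%:R + m%:R != 0 :> R by rewrite gt_eqF.
(* For [m <= k] every term is a rational multiple of [A k.+1 m], which leaves an identity of
   rational functions. Beyond [k.+1] all terms are 0, and at [k.+1] only the two diagonal
   coefficients survive. *)
case: (ltngtP m k.+1) => h.
- have hd := natr_sub_gt0 h.
  rewrite (envCoefS h).
  have -> : (a ^+ 2 - k%:R ^+ 2) ^+ 2 * A k m =
     (a ^+ 2 - k%:R ^+ 2) * (k%:R - m%:R) / (k%:R + m%:R) * A k.+1 m.
    apply: (mulIf kmn).
    transitivity ((a ^+ 2 - k%:R ^+ 2) *
                  ((a ^+ 2 - k%:R ^+ 2) * (k%:R + m%:R) * A k m)); first by ring.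
    by rewrite -envCoef_mulS; field.
  have -> : (if m is l.+1 then (2 * l%:R + 1) * A k.+1 l else 0) =
     2 * m%:R * (a ^+ 2 - m%:R ^+ 2) / ((k.+1%:R - m%:R) * (k%:R + m%:R)) * A k.+1 m.
    case: m h hd km kmn => [|l] h hd km kmn; first by rewrite mulr0 !mul0r.
    have hdn : k.+1%:R - l.+1%:R != 0 :> R by rewrite gt_eqF.
    have h2 : (k.+1%:R - l.+1%:R) * (k%:R + l.+1%:R) != 0 :> R by rewrite mulf_neq0.
    apply: (mulfI h2).
    transitivity ((k.+1%:R - l%:R - 1) * (k.+1%:R + l%:R) * (2 * l%:R + 1) * A k.+1 l).
      by rewrite -(natr1 k) -(natr1 l); ring.
    rewrite envCoef_shift.
    have -> : 2 * l%:R + 2 = 2 * l.+1%:R :> R by rewrite -(natr1 l); ring.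
    by set D := (_ * (k%:R + _)) in h2 *; field.
  have hdn : k.+1%:R - m%:R != 0 :> R by rewrite gt_eqF.
  move: hdn; rewrite -(natr1 k) => hdn.
  by field; rewrite hdn kmn.
- rewrite !envCoef_out ?(ltnW h) //; last by rewrite ltnW // ltnW.
  case: m h {km kmn} => // l h; rewrite envCoef_out //; ring.
- rewrite h envCoef_diag (envCoef_diag k) big_ord_recr /=.
  by rewrite !envCoef_out // -!(natr1 k); ring.
Qed.

Lemma envCoef_ge0 k m : k%:R <= a -> 0 <= A k m.
Proof.
move=> ka; rewrite /envCoef; case: ifP => // mk.
apply: mulr_ge0; first by rewrite mulr_ge0 ?sqr_ge0.
rewrite big_nat.
apply: prodr_ge0 => j /andP[mj jk].
have ja : j%:R <= a by apply: le_trans ka; rewrite ler_nat ltnW.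
have a2 : 0 <= a ^+ 2 - j%:R ^+ 2.
  by rewrite subr_ge0 ler_sqr ?nnegrE // (le_trans _ ja).
apply: divr_ge0; first by rewrite (mulr_ge0 a2) ?addr_ge0.
by rewrite subr_ge0 ler_nat ltnW.
Qed.

End EnvelopeCoefficients.

(* [(envPoly a k).[q]] is [G_k] as a polynomial in [q = 1 + c^2 = 1 / sin^2 t]. *)
Definition envPoly (R : realFieldType) (a : R) (k : nat) : {poly R} :=
  \poly_(m < k) envCoef a k m.

(** * Identities and signs for the envelope polynomials *)

Section EnvelopePolynomials.
Variables (R : realFieldType) (a : R).
Local Notation P := (envPoly a).

Lemma coef_envPoly k m : (P k)`_m = envCoef a k m.
Proof. by rewrite coef_poly; case: ltnP => // h; rewrite envCoef_out. Qed.

Lemma envPoly1 : P 1 = (a ^+ 2)%:P.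
Proof.
apply/polyP => m; rewrite coef_envPoly coefC; case: m => [|m] /=.
  by rewrite envCoef_diag big_ord0 expr1n mulr1.
by rewrite envCoef_out.
Qed.

Lemma envPoly2 : P 2 = (a ^+ 2)%:P * ('X + (a ^+ 2 - 1)%:P).
Proof.
apply/polyP => m; rewrite coef_envPoly coefCM coefD coefX coefC.
case: m => [|[|m]] /=.
- rewrite envCoefS // envCoef_diag big_ord0 subr0 divr1; ring.
- by rewrite envCoef_diag big_ord1 /= mulr0 add0r expr1n addr0.
- by rewrite envCoef_out // addr0 mulr0.
Qed.

(** Coefficientwise this is [envCoef_rec]: p -> 2qp' + p multiplies the coefficient of q^m by 2m+1,
    and ['X - 1] stands for c^2. *)
Lemma envPoly_rec k : (0 < k)%N ->
  P k.+2 = (2 * k%:R + 1)%:P *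
      (('X - 1) * (2%:P * 'X * (P k.+1)^`() + P k.+1))
    + ((a ^+ 2 - k%:R ^+ 2) ^+ 2)%:P * P k.
Proof.
move=> k0; apply/polyP => m.
rewrite coefD !coefCM mulrBl mul1r coefB coefXM.
have E l : (2%:P * 'X * (P k.+1)^`() + P k.+1)`_l = (2 * l%:R + 1) * envCoef a k.+1 l.
  rewrite coefD -mulrA coefCM coefXM coef_envPoly.
  case: l => [|l] /=; first by rewrite mulr0n; ring.
  by rewrite coef_deriv coef_envPoly -mulr_natr; ring.
by rewrite !E !coef_envPoly envCoef_rec //; case: m.
Qed.

(** This is H_(k+1) = (2k+1) c G_(k+1) - (a^2-k^2) H_k after substituting H_k = c (k G_k + q G_k')
    and dividing by c; coefficientwise it is [envCoef_mulS]. *)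
Lemma envPoly_deriv k :
  'X * (P k.+1)^`() = k%:R%:P * P k.+1
    - (a ^+ 2 - k%:R ^+ 2)%:P * (k%:R%:P * P k + 'X * (P k)^`()).
Proof.
have E j l : ('X * (P j)^`())`_l = l%:R * envCoef a j l.
  rewrite coefXM; case: l => [|l] /=; first by rewrite mulr0n mul0r.
  by rewrite coef_deriv coef_envPoly mulr_natl.
apply/polyP => m; rewrite coefB !coefCM coefD coefCM !E !coef_envPoly.
have := envCoef_mulS a k m.
move: (envCoef a k.+1 m) (envCoef a k m) (k%:R : R) (m%:R : R) => x y z t H.
apply: subr0_eq.
transitivity ((a ^+ 2 - z ^+ 2) * (z + t) * y - (z - t) * x); first by ring.
by rewrite H subrr.
Qed.

Lemma envPoly_deriv_ge0 k q : k%:R <= a -> 0 <= q -> 0 <= (P k)^`().[q].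
Proof.
move=> ka q0; rewrite horner_coef sumr_ge0 // => i _.
by rewrite coef_deriv coef_envPoly mulr_ge0 ?exprn_ge0 ?mulrn_wge0 // envCoef_ge0.
Qed.

Lemma envPoly_ge0 k q : k%:R <= a -> 0 <= q -> 0 <= (P k).[q].
Proof.
move=> ka q0; rewrite horner_coef sumr_ge0 // => i _.
by rewrite coef_envPoly mulr_ge0 ?exprn_ge0 // envCoef_ge0.
Qed.

End EnvelopePolynomials.

(** The outermost factors n+k+1 and n-k-1 multiply to n^2-(k+1)^2; the inner ones are the shorter
    product with its index shifted. *)
Lemma double_step_prodSS (R : realFieldType) (n k : nat) :
  \prod_(1 <= j < k.+3) (n%:R + k.+2%:R + 1 - 2 * j%:R) =
  (n%:R ^+ 2 - k.+1%:R ^+ 2) * \prod_(1 <= j < k.+1) (n%:R + k%:R + 1 - 2 * j%:R) :> R.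
Proof.
rewrite big_nat_recr //= big_ltn // big_add1 /=.
rewrite (eq_bigr (fun j : nat => n%:R + k%:R + 1 - 2 * j%:R)); last first.
  by move=> j _; rewrite -!natr1; ring.
by rewrite -!natr1; ring.
Qed.

(** * Wronskian and envelope of two solutions of the recurrence *)

Section Envelope.
Variables (R : realFieldType) (n : nat) (c : R).
Variables u v : nat -> R.
Hypothesis uSS : forall k, u k.+2 =
  (2 * k%:R + 1) * c * u k.+1 - (n%:R ^+ 2 - k%:R ^+ 2) * u k.
Hypothesis vSS : forall k, v k.+2 =
  (2 * k%:R + 1) * c * v k.+1 - (n%:R ^+ 2 - k%:R ^+ 2) * v k.
Hypothesis uv0 : u 0%N ^+ 2 + v 0%N ^+ 2 = 1.
Hypothesis u1 : u 1%N = n%:R * v 0%N.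
Hypothesis v1 : v 1%N = - (n%:R * u 0%N).

Let q := 1 + c ^+ 2.
Let G k := u k ^+ 2 + v k ^+ 2.
Let H k := u k * u k.+1 + v k * v k.+1.
Local Notation P := (envPoly (n%:R : R)).

Let q0 : 0 <= q.
Proof. by rewrite addr_ge0 ?sqr_ge0. Qed.

Let HS k : H k.+1 = (2 * k%:R + 1) * c * G k.+1 - (n%:R ^+ 2 - k%:R ^+ 2) * H k.
Proof. by rewrite /H /G uSS vSS; ring. Qed.

Let GSS k : G k.+2 = (2 * k%:R + 1) * c * (2 * H k.+1 - (2 * k%:R + 1) * c * G k.+1)
  + (n%:R ^+ 2 - k%:R ^+ 2) ^+ 2 * G k.
Proof. by rewrite HS /H /G uSS vSS; ring. Qed.

(** The terms in [c] cancel, so each step multiplies the determinant by n^2-k^2. *)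
Lemma wronskian_rec k : u k * v k.+1 - u k.+1 * v k =
  - (n%:R * \prod_(j < k) (n%:R ^+ 2 - j%:R ^+ 2)).
Proof.
elim: k => [|k IH].
  rewrite big_ord0 u1 v1 mulr1 -[in RHS](mulr1 n%:R) -uv0; ring.
rewrite big_ord_recr /= uSS vSS.
transitivity ((n%:R ^+ 2 - k%:R ^+ 2) * (u k * v k.+1 - u k.+1 * v k)); first by ring.
by rewrite IH; ring.
Qed.

(** The formula for [H] reflects dG_k/dt = 2kc G_k - 2 H_k together with dq/dt = -2cq. The proof is
    algebraic; it carries two successive values of [G] because [GSS] goes two steps back. *)
Lemma envelope_poly k :
  [/\ G k.+1 = (P k.+1).[q],
      H k.+1 = c * (k.+1%:R * (P k.+1).[q] + q * (P k.+1)^`().[q]) &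
      G k.+2 = (P k.+2).[q]].
Proof.
have G1 : G 1 = n%:R ^+ 2.
  by rewrite /G u1 v1 -[RHS]mulr1 -uv0; ring.
have H0 : H 0 = 0 by rewrite /H u1 v1; ring.
have H1 : H 1 = c * n%:R ^+ 2 by rewrite HS H0 G1; ring.
elim: k => [|k [IG IH IGS]].
  split; first by rewrite envPoly1 hornerC.
    by rewrite envPoly1 derivC horner0 hornerC H1; ring.
  rewrite envPoly2 GSS H1 G1 /(G 0%N) uv0 !(hornerM, hornerD, hornerC, hornerX, hornerN) /q.
  by ring.
have IHS : H k.+2 = c * (k.+2%:R * (P k.+2).[q] + q * (P k.+2)^`().[q]).
  have /(congr1 (fun p => p.[q])) := envPoly_deriv (n%:R : R) k.+1.
  rewrite !(hornerM, hornerD, hornerC, hornerX, hornerN) => ->.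
  by rewrite HS IH IGS -!(natr1 k.+1); ring.
split=> //.
rewrite envPoly_rec // GSS IHS IGS IG.
rewrite !(hornerM, hornerD, hornerC, hornerX, hornerN).
rewrite -!(natr1 k.+1) /q; ring.
Qed.

(** In [GSS] the extra term equals (2k+1) c^2 (2qP' + P) with P = [P k.+1] at q, and the
    coefficients of P are nonnegative since k+1 <= n. *)
Lemma envelope_step k : (k < n)%N ->
  (n%:R ^+ 2 - k%:R ^+ 2) ^+ 2 * G k <= G k.+2.
Proof.
move=> kn.
have [EG EH _] := envelope_poly k.
rewrite GSS lerDr EH EG.
have kna : k.+1%:R <= n%:R :> R by rewrite ler_nat.
have p0 := envPoly_ge0 kna q0.
have d0 := envPoly_deriv_ge0 kna q0.
rewrite (_ : _ * _ = (2 * k%:R + 1) *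
    (c ^+ 2 * (2 * (q * (P k.+1)^`().[q]) + (P k.+1).[q]))).
  apply: mulr_ge0; first by rewrite addr_ge0 // mulr_ge0.
  apply: mulr_ge0; first exact: sqr_ge0.
  by rewrite addr_ge0 // !mulr_ge0.
rewrite -(natr1 k); ring.
Qed.

Lemma envelope_ge k : (k <= n)%N ->
  (n%:R * \prod_(1 <= j < k.+1) (n%:R + k%:R + 1 - 2 * j%:R)) ^+ 2 <= G k.+1.
Proof.
(* The step has length two, hence the auxiliary bound [K]. The base cases are G_1 = n^2 and G_2 >=
   n^4, the latter from G_0 = 1. *)
move: k {-2}k (leqnn k) => K; elim: K => [|K IH] [|[|k]] //.
- move=> _ _; have [-> _ _] := envelope_poly 0.
  by rewrite envPoly1 hornerC big_geq // mulr1.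
- move=> _ _; have [-> _ _] := envelope_poly 0.
  by rewrite envPoly1 hornerC big_geq // mulr1.
- move=> _ n0; apply: le_trans (envelope_step n0).
  rewrite big_nat1 /G uv0 (_ : (_ * _) = n%:R ^+ 2); last by ring.
  by rewrite (_ : _ * 1 = (n%:R ^+ 2) ^+ 2) //; ring.
- rewrite ltnS => kK kn.
  apply: le_trans (envelope_step kn).
  rewrite double_step_prodSS mulrCA exprMn ler_wpM2l ?sqr_ge0 // IH //.
    exact: ltnW.
  exact/ltnW/ltnW.
Qed.

Lemma critical_bound k : (k < n)%N -> u k.+1 = 0 ->
  `|u k| <= (\prod_(j < k) (n%:R ^+ 2 - j%:R ^+ 2)) /
            \prod_(1 <= j < k.+1) (n%:R + k%:R + 1 - 2 * j%:R).
Proof.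
move=> kn uk.
set N := \prod_(_ < k) _; set D := \prod_(_ <= _ < _) _.
have n0 : 0 < n%:R :> R by rewrite ltr0n (leq_ltn_trans _ kn).
have N0 : 0 <= N.
  apply: prodr_ge0 => j _; rewrite subr_ge0 ler_sqr ?nnegrE ?ler0n // ler_nat.
  by rewrite ltnW // (ltn_trans _ kn).
have D0 : 0 < D.
  rewrite /D big_nat; apply: prodr_gt0 => j /andP[j1 jk].
  have : j%:R <= k%:R :> R by rewrite ler_nat.
  have : k.+1%:R <= n%:R :> R by rewrite ler_nat.
  rewrite -natr1; lra.
rewrite ler_pdivlMr //.
have W := wronskian_rec k; rewrite -/N uk mul0r subr0 in W.
have := envelope_ge (ltnW kn); rewrite -/D /G uk expr0n /= add0r => B.
have {}B : n%:R * D <= `|v k.+1|.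
  by rewrite -ler_sqr ?nnegrE ?mulr_ge0 ?(ltW D0) ?ler0n // real_normK ?num_real.
have {}W : `|u k| * `|v k.+1| = n%:R * N.
  by rewrite -normrM W normrN ger0_norm // mulr_ge0 ?ler0n.
rewrite -(ler_pM2l n0) -W mulrCA ler_wpM2l //.
Qed.

End Envelope.

(** * Differential equation, values at 1 and zeros of the derivatives of T_n *)

Section Chebyshev.
Variable R : realType.
Local Notation T := (chebyshevT R).

(** Polynomial forms of sin^2 t T_m'(cos t) = m sin t sin(mt) for m = n and m = n+1; the pair makes
    the three-term recurrence inductive. *)
Lemma chebyshevT_deriv n :
  (1 - 'X ^+ 2) * (T n)^`() = n%:R%:P * ('X * T n - T n.+1) /\
  (1 - 'X ^+ 2) * (T n.+1)^`() = n.+1%:R%:P * (T n - 'X * T n.+1).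
Proof.
elim: n => [|n [IH0 IH1]].
  by rewrite /= derivC derivX; split; ring.
split.
  by rewrite IH1 chebyshevTSS; ring.
rewrite chebyshevTSS derivB !derivM derivC derivX.
transitivity (2%:P * ((1 - 'X ^+ 2) * T n.+1) + 2%:P * 'X * ((1 - 'X ^+ 2) * (T n.+1)^`())
   - (1 - 'X ^+ 2) * (T n)^`()); first by ring.
rewrite IH0 IH1 -!natr1 !polyCD !polyC1; ring.
Qed.

Lemma deriv_1subX2 : (1 - 'X ^+ 2 : {poly R})^`() = - (2%:P * 'X).
Proof. by rewrite derivB derivXn -polyC1 derivC; ring. Qed.

Lemma chebyshevT_ode n :
  (1 - 'X ^+ 2) * (T n)^`(2) = 'X * (T n)^`() - (n%:R ^+ 2)%:P * T n.
Proof.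
have [E0 E1] := chebyshevT_deriv n.
have p0 : (1 - 'X ^+ 2 : {poly R}) != 0.
  apply/eqP => /(congr1 (fun p => p.[0])).
  rewrite !(hornerE, hornerXn) expr0n subr0 => /eqP; exact/negP/oner_neq0.
(* The spare factor 1 - X^2 allows [chebyshevT_deriv] to eliminate the first derivatives of both T_n
   and T_(n+1). *)
apply: (mulfI p0).
have /(congr1 (fun p => (1 - 'X ^+ 2) * p^`())) := E0.
rewrite derivM deriv_1subX2 derivM derivC derivB derivM derivX mul0r add0r => E2.
have -> : (1 - 'X ^+ 2) * ((1 - 'X ^+ 2) * (T n)^`()^`()) = 
   (1 - 'X ^+ 2) * (- (2%:P * 'X) * (T n)^`() + (1 - 'X ^+ 2) * (T n)^`()^`())
   + 2%:P * 'X * ((1 - 'X ^+ 2) * (T n)^`()) by ring.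
rewrite E2.
transitivity (n%:R%:P * ((1 - 'X ^+ 2) * T n + 'X * ((1 - 'X ^+ 2) * (T n)^`())
     - (1 - 'X ^+ 2) * (T n.+1)^`())
   + 2%:P * 'X * ((1 - 'X ^+ 2) * (T n)^`())).
  by ring.
transitivity ('X * ((1 - 'X ^+ 2) * (T n)^`())
   - (1 - 'X ^+ 2) * ((n%:R ^+ 2)%:P * T n)); last by ring.
rewrite E0 E1 -natr1 polyCD polyC1 polyC_exp; ring.
Qed.

Lemma chebyshevT_derivn_ode n k :
  (1 - 'X ^+ 2) * (T n)^`(k.+2) =
  (2 * k%:R + 1)%:P * 'X * (T n)^`(k.+1) - (n%:R ^+ 2 - k%:R ^+ 2)%:P * (T n)^`(k).
Proof.
elim: k => [|k IH].
  by rewrite chebyshevT_ode mulr0 add0r expr0n subr0 mul1r.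
have /(congr1 (@deriv R)) := IH.
rewrite derivB derivM deriv_1subX2 !derivM !derivC derivX -!derivnS.
rewrite !mul0r !add0r mulr1 => E.
transitivity (- (2%:P * 'X) * (T n)^`(k.+2) + (1 - 'X ^+ 2) * (T n)^`(k.+3)
   + 2%:P * 'X * (T n)^`(k.+2)); first by ring.
rewrite E -!natr1 !(polyCD, polyCB, polyCM, polyC_exp, polyC1); ring.
Qed.

Lemma chebyshevT_derivn_horner n k x :
  (1 - x ^+ 2) * (T n)^`(k.+2).[x] =
  (2 * k%:R + 1) * x * (T n)^`(k.+1).[x] - (n%:R ^+ 2 - k%:R ^+ 2) * (T n)^`(k).[x].
Proof.
have /(congr1 (fun p => p.[x])) := chebyshevT_derivn_ode n k.
by rewrite !(hornerM, hornerD, hornerN, hornerC, hornerX, hornerXn).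
Qed.

(** At x = 1 the leading term of the differential equation drops out, leaving (2k+1) T_n^(k+1)(1) =
    (n^2-k^2) T_n^(k)(1). *)
Lemma chebyshevT_derivn_at1 n k :
  (odd_dfact k)%:R * (T n)^`(k).[1] = \prod_(j < k) (n%:R ^+ 2 - j%:R ^+ 2).
Proof.
elim: k => [|k IH].
  by rewrite /odd_dfact !big_ord0 mul1r -(cos0 R) chebyshevT_cos mulr0.
rewrite /odd_dfact !big_ord_recr /= -IH natrM natrD natrM.
have := chebyshevT_derivn_horner n k 1; rewrite expr1n subrr mul0r mulr1 => /eqP.
rewrite eq_sym subr_eq0 => /eqP E.
by rewrite -mulrA E /odd_dfact; ring.
Qed.

Lemma odd_dfact_gt0 k : (0 < odd_dfact k)%N.
Proof. by rewrite /odd_dfact prodn_gt0 // => i; rewrite addn1. Qed.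

Lemma chebyshevT_derivn_at1_gt0 n k : (k <= n)%N -> 0 < (T n)^`(k).[1].
Proof.
move=> kn; rewrite -(pmulr_rgt0 _ (_ : 0 < (odd_dfact k)%:R)) ?ltr0n ?odd_dfact_gt0 //.
rewrite chebyshevT_derivn_at1; apply: prodr_gt0 => j _.
by rewrite subr_gt0 ltr_sqr ?nnegrE // ltr_nat (leq_trans _ kn).
Qed.

Lemma chebyshevT_derivn_at1_ge0 n k : 0 <= (T n)^`(k).[1].
Proof.
case: (leqP k n) => [kn|nk]; first exact/ltW/chebyshevT_derivn_at1_gt0.
have h : 0 < (odd_dfact k)%:R :> R by rewrite ltr0n odd_dfact_gt0.
rewrite -(pmulr_rge0 _ h) chebyshevT_derivn_at1.
(* For k > n the product contains the zero factor j = n. *)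
by rewrite (bigD1 (Ordinal nk)) //= subrr mul0r.
Qed.

(** Taylor expansion at 1: the constant term is positive and all other coefficients are
    nonnegative. *)
Lemma chebyshevT_derivn_gt0 n k x : (k <= n)%N -> 1 <= x -> 0 < (T n)^`(k).[x].
Proof.
move=> kn x1.
have -> : x = 1 + (x - 1) by ring.
rewrite (nderiv_taylor _ (mulrC 1 _)).
have [s Es] : exists s, size (T n)^`(k) = s.+1.
  exists (size (T n)^`(k)).-1; rewrite prednK // size_poly_gt0.
  apply: contraTneq (chebyshevT_derivn_at1_gt0 kn) => ->.
  by rewrite horner0 ltxx.
rewrite Es big_ord_recl /= expr0 mulr1 nderivn0 ltr_wpDr ?chebyshevT_derivn_at1_gt0 //.
apply: sumr_ge0 => i _; rewrite mulr_ge0 ?exprn_ge0 ?subr_ge0 //.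
set j := bump _ _.
have h : 0 < j`!%:R :> R by rewrite ltr0n fact_gt0.
rewrite -(pmulr_lge0 _ h) mulr_natr -hornerMn -nderivn_def /derivn -iterD.
exact: (chebyshevT_derivn_at1_ge0 n (j + k)).
Qed.

Lemma chebyshevT_comp_opp n : T n \Po (- 'X) = (-1) ^+ n *: T n.
Proof.
suff [] : T n \Po (- 'X) = (-1) ^+ n *: T n /\
  T n.+1 \Po (- 'X) = (-1) ^+ n.+1 *: T n.+1 by [].
elim: n => [|n [IH0 IH1]].
  by split; rewrite /= ?comp_polyC ?comp_polyX ?expr1 ?scaleN1r // expr0 scale1r.
split=> //; rewrite chebyshevTSS comp_polyB !comp_polyM comp_polyC comp_polyX IH0 IH1.
by rewrite -!mul_polyC !exprS !polyCM polyCN polyC1; ring.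
Qed.

Lemma chebyshevT_derivn_comp_opp n k :
  (T n)^`(k) \Po (- 'X) = (-1) ^+ (n + k) *: (T n)^`(k).
Proof.
elim: k => [|k IH]; first by rewrite addn0 chebyshevT_comp_opp.
have /(congr1 (@deriv R)) := IH.
rewrite deriv_comp derivN derivX mulrN1 derivZ -!derivnS => /(congr1 -%R).
by rewrite opprK => ->; rewrite addnS exprS mulN1r scaleNr.
Qed.

(** Positivity on [1, oo) excludes zeros there, and parity carries this over to (-oo, -1]. *)
Lemma root_chebyshevT_derivn n k x : (k <= n)%N ->
  root (T n)^`(k) x -> -1 < x < 1.
Proof.
move=> kn rx.
have lt1 y : root (T n)^`(k) y -> y < 1.
  move=> ry; rewrite ltNge; apply/negP => y1.
  by have := chebyshevT_derivn_gt0 kn y1; rewrite (eqP ry) ltxx.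
rewrite lt1 // andbT ltrNl lt1 //.
have /(congr1 (fun p => p.[x])) := chebyshevT_derivn_comp_opp n k.
by rewrite horner_comp hornerN hornerX hornerZ (eqP rx) mulr0 /root => ->.
Qed.

End Chebyshev.

(** * Specialisation to w = cos t, with c = [w / s] = cot t *)

Theorem theorem1p2 (R : realType) (n k : nat) (w : R)
    (hk : (1 <= k)%N) (hn : (k + 1 < n)%N)
    (hw : is_largest_root ((chebyshevT R n)^`(k.+1)) w) :
  tau n k w <=
    (odd_dfact k)%:R
      / (\prod_(1 <= j < k.+1) (n%:R + k%:R + 1 - 2 * j%:R))
      * (1 / (1 - w ^+ 2) `^ (k%:R / 2)).
Proof.
have [rw _] := hw.
rewrite addn1 in hn.
have /andP[w1 w2] := root_chebyshevT_derivn (ltnW hn) rw.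
pose t := acos w.
have ct : cos t = w by rewrite /t acosK // in_itv /= !ltW.
have p0 : 0 < 1 - w ^+ 2.
  rewrite (_ : _ - _ = (1 - w) * (1 + w)); last by ring.
  by rewrite mulr_gt0 // ?subr_gt0 // -ltrBlDl sub0r.
pose s := sin t.
have s2 : s ^+ 2 = 1 - w ^+ 2 by rewrite /s sin2cos2 ct.
have s0 : 0 < s.
  rewrite lt_neqAle sin_ge0_pi ?andbT.
    by rewrite eq_sym -sqrf_eq0 s2 gt_eqF.
  by rewrite acos_ge0 ?acos_lepi // !ltW.
have sn0 : s != 0 by rewrite gt_eqF.
have kn : (k < n)%N by apply: ltnW.
pose y j := (chebyshevT R n)^`(j).[w].
pose u j := s ^+ j * y j.
have uSS j : u j.+2 = (2 * j%:R + 1) * (w / s) * u j.+1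
                      - (n%:R ^+ 2 - j%:R ^+ 2) * u j.
  have E := chebyshevT_derivn_horner n j w; rewrite -s2 -/(y _) -/(y _) -/(y _) in E.
  rewrite /u; transitivity (s ^+ j * (s ^+ 2 * y j.+2)); first by rewrite !exprS; ring.
  by rewrite E !exprS; field.
(* [v] solves the same recurrence with initial values [sin (n t)],
   [- n cos (n t)]: it is the normalised derivative of [sin (n arccos x)]. *)
pose vv := fix vv (j : nat) : R * R :=
  if j is i.+1 then ((vv i).2, (2 * i%:R + 1) * (w / s) * (vv i).2
                      - (n%:R ^+ 2 - i%:R ^+ 2) * (vv i).1)
  else (sin (n%:R * t), - (n%:R * cos (n%:R * t))).
pose v j := (vv j).1.
have u0E : u 0%N = cos (n%:R * t) by rewrite /u mul1r /y derivn0 -ct chebyshevT_cos.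
have u1E : u 1%N = n%:R * v 0%N.
  (* At cos t the derivative identity reads s^2 T_n'(w) = n s sin(nt), by the addition formula for
     cos(nt + t); then one factor s is cancelled. *)
  have [/(congr1 (fun p => p.[cos t]))+ _] := chebyshevT_deriv R n.
  rewrite !(hornerM, hornerD, hornerN, hornerC, hornerX, hornerXn) !chebyshevT_cos.
  have -> : n.+1%:R * t = n%:R * t + t by rewrite -natr1 mulrDl mul1r.
  rewrite cosD -sin2cos2 -/s ct => E.
  rewrite /u /y /v /= expr1; apply: (mulfI sn0).
  rewrite mulrA -expr2 E; ring.
have v1E : v 1%N = - (n%:R * u 0%N) by rewrite u0E.
have uv : u 0%N ^+ 2 + v 0%N ^+ 2 = 1 by rewrite u0E cos2Dsin2.
have uk : u k.+1 = 0 by rewrite /u /y (eqP rw) mulr0.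
have B := critical_bound uSS (fun j => erefl : v j.+2 = _) uv u1E v1E kn uk.
have -> : (1 - w ^+ 2) `^ (k%:R / 2) = s ^+ k.
  rewrite -s2 -powR_mulrn ?(ltW s0) // -powRrM -powR_mulrn ?(ltW s0) //.
  by congr (_ `^ _); field.
have sk : 0 < s ^+ k by rewrite exprn_gt0.
have d0 : 0 < (odd_dfact k)%:R :> R by rewrite ltr0n odd_dfact_gt0.
have T1 := chebyshevT_derivn_at1_gt0 R (ltnW kn).
(* Clearing T_n^(k)(1) and multiplying by s^k turns the left side into |u_k|; the numerator in
   [critical_bound] is (2k-1)!! T_n^(k)(1). *)
rewrite /tau ler_pdivrMr // mul1r -(ler_pM2l sk).
rewrite -(gtr0_norm sk) -normrM (le_trans B) // -chebyshevT_derivn_at1 gtr0_norm //.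
rewrite [leRHS](_ : _ = (odd_dfact k)%:R * (chebyshevT R n)^`(k).[1] *
  (\prod_(1 <= j < k.+1) (n%:R + k%:R + 1 - 2 * j%:R))^-1 * (s ^+ k / s ^+ k)).
  by rewrite divff ?gt_eqF // mulr1.
ring.
Qed.
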